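(* For every positive integer $n$ we have $l_n\geq \frac{1}{2\sqrt{n}}$.
   Context: For a real orthogonal $n\times n$ matrix $M=(m_{i,j})$ let $l_M:=\min_{1\le i,j\le n}|m_{i,j}|$, and let $l_n:=\max_{M\in O(n)} l_M$, where $O(n)$ denotes the group of real orthogonal $n\times n$ matrices. *)

(* Defs.v *)
From mathcomp Require Import all_boot all_order all_algebra.
From mathcomp Require Import boolp classical_sets reals.
Set Implicit Arguments. Unset Strict Implicit. Unset Printing Implicit Defensive.
Import Order.TTheory GRing.Theory Num.Theory.
Local Open Scope ring_scope.
Local Open Scope classical_set_scope.

Definition orthogonal_mx (R : realType) (n : nat) (M : 'M[R]_n) : Prop :=
  M *m M^T = 1%:M.

(* l_M := min_{i,j} |m_{ij}|, for an (n+1) x (n+1) matrix (n+1 >= 1, so the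
   minimum over a nonempty index set; the initial value is an actual entry). *)
Definition lM (R : realType) (n : nat) (M : 'M[R]_n.+1) : R :=
  \big[Num.min/`|M ord0 ord0|]_(i < n.+1) \big[Num.min/`|M ord0 ord0|]_(j < n.+1) `|M i j|.

(* l_{n+1} := max over O(n+1) of l_M, expressed as the supremum of the set of
   values l_M (this maximum is attained by compactness of O(n+1)). *)
Definition l_ (R : realType) (n : nat) : R :=
  sup [set lM M | M in [set M : 'M[R]_n.+1 | orthogonal_mx M]].

(* Main.v *)
Require Import Defs.
From mathcomp Require Import all_boot all_order all_algebra.
From mathcomp Require Import boolp classical_sets reals.
From mathcomp Require Import topology normedtype derive.
From mathcomp Require Import ring lra.
Import Order.TTheory GRing.Theory Num.Theory.
Import numFieldNormedType.Exports.
Local Open Scope ring_scope.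

(* Take M in O(n) maximizing the entrywise l1 norm, and let S be its sign
   pattern, P = M S^T. Then tr(X S'^T) <= tr P for every X in O(n) and every sign
   pattern S'. For an entry d = m_ij, rotate M in the plane spanned by e = e_i and
   v = M e_j. With S' = S, optimality makes P symmetric on this plane; with S'
   equal to S flipped at (i, j), it gives 1 <= T |d|, where T is the trace of P on
   the plane, that is (1 - d^2) T = r + c - 2 |d| for r and c the l1 norms of the
   i-th row and j-th column. Hence 1 + d^2 <= |d| (r + c) <= 2 sqrt(n) |d|. *)

(** * Entry and row bounds for orthogonal matrices *)

Definition l1norm (R : realType) n (M : 'M[R]_n) : R :=
  \sum_i \sum_j `|M i j|.
Arguments l1norm {R n} M.

Lemma orthogonal_row_sqr (R : realType) n (M : 'M[R]_n) i :
  orthogonal_mx M -> \sum_j M i j ^+ 2 = 1.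
Proof.
move=> /matrixP/(_ i i); rewrite !mxE eqxx mulr1n => <-.
by apply: eq_bigr => j _; rewrite mxE expr2.
Qed.

Lemma orthogonal_mx_tr (R : realType) n (M : 'M[R]_n) :
  orthogonal_mx M -> orthogonal_mx M^T.
Proof. by move=> oM; rewrite /orthogonal_mx trmxK; exact: mulmx1C. Qed.

Lemma orthogonal_mxM (R : realType) n (M N : 'M[R]_n) :
  orthogonal_mx M -> orthogonal_mx N -> orthogonal_mx (M *m N).
Proof.
move=> oM oN; rewrite /orthogonal_mx trmx_mul mulmxA -(mulmxA M) oN mulmx1.
exact: oM.
Qed.

Lemma orthogonal_entry_le1 (R : realType) n (M : 'M[R]_n) i j :
  orthogonal_mx M -> `|M i j| <= 1.
Proof.
move=> /(orthogonal_row_sqr _ _ _ i) h.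
rewrite -(@expr_le1 _ 2)// real_normK ?num_real// -h (bigD1 j)//= lerDl.
by apply: sumr_ge0 => k _; exact: sqr_ge0.
Qed.

Lemma orthogonal_row_l1_le (R : realType) n (M : 'M[R]_n) i :
  orthogonal_mx M -> \sum_j `|M i j| <= Num.sqrt n%:R.
Proof.
move=> oM; have n0 : (0 < n)%N by case: n M i oM => [|//] M [].
set q := Num.sqrt n%:R; have q0 : 0 < q by rewrite sqrtr_gt0 ltr0n.
have q2 : q ^+ 2 = n%:R by rewrite sqr_sqrtr.
(* AM-GM: 2 |m| <= q m^2 + 1/q *)
have le j : `|M i j| <= (q * M i j ^+ 2 + q^-1) / 2.
  rewrite -(real_normK (num_real (M i j))).
  have -> : (q * `|M i j| ^+ 2 + q^-1) / 2 =
            `|M i j| + q * (`|M i j| - q^-1) ^+ 2 / 2.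
    by field; rewrite gt_eqF.
  by rewrite lerDl divr_ge0// mulr_ge0 ?sqr_ge0// ltW.
apply: (le_trans (ler_sum _ (fun j _ => le j))).
rewrite -mulr_suml big_split/= -mulr_sumr orthogonal_row_sqr// mulr1.
rewrite sumr_const card_ord -[q^-1 *+ n]mulr_natr -q2.
suff -> : (q + q^-1 * q ^+ 2) / 2 = q by [].
by field; rewrite gt_eqF.
Qed.

(** * Existence of an l1-maximizer *)

Lemma continuous_vec_mx (R : realType) m n i j :
  continuous (fun v : 'rV[R]_(m * n) => vec_mx v i j).
Proof.
have -> : (fun v : 'rV[R]_(m * n) => vec_mx v i j) =
          (fun v : 'rV[R]_(m * n) => v 0 (mxvec_index i j)).
  by apply/funext => v; rewrite mxE.
exact: coord_continuous.
Qed.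

(** O(n) is compact: it is cut out by polynomial equations in the entries, and its entries lie in
    [-1, 1]. Matrices are flattened to row vectors so that [rV_compact] and [EVT_max_rV] apply. *)
Lemma orthogonal_l1norm_max (R : realType) n :
  exists2 M : 'M[R]_n, orthogonal_mx M &
    forall N : 'M[R]_n, orthogonal_mx N -> l1norm N <= l1norm M.
Proof.
pose A := [set v : 'rV[R]_(n * n) | orthogonal_mx (vec_mx v)]%classic.
have A0 : (A !=set0)%classic.
  by exists (mxvec 1%:M); rewrite /A/= mxvecK /orthogonal_mx trmx1 mulmx1.
have clA : closed A.
  rewrite (_ : A = (\bigcap_(ij in setT)
    ((fun v : 'rV[R]_(n * n) => \sum_k vec_mx v ij.1 k * vec_mx v ij.2 k)
      @^-1` [set x | x = (ij.1 == ij.2)%:R]))%classic); last first.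
    apply/seteqP; split => v /=.
      move=> oM [i j] _ /=; have /matrixP/(_ i j) := oM; rewrite !mxE => <-.
      by apply: eq_bigr => k _; rewrite !mxE.
    move=> h; apply/matrixP => i j; rewrite !mxE.
    rewrite -[RHS](h (i, j) I).
    by apply: eq_bigr => k _; rewrite [X in _ * X = _]mxE.
  apply: closed_bigI => -[i j] _ /=.
  have /continuous_closedP : continuous
      (fun v : 'rV[R]_(n * n) => \sum_k vec_mx v i k * vec_mx v j k); last first.
    by apply; exact: closed_eq.
  apply: continuous_big => [|k _]; first exact: add_continuous.
  by move=> v; apply: continuousM; exact: continuous_vec_mx.
have cA : compact A.
  have cB : compact [set v : 'rV[R]_(n * n) |
      forall i, (v ord0 i \in `[(-1 : R), 1])%R]%classic.
    apply: (@rV_compact _ _ (fun=> `[(-1 : R), 1]%classic)) => _.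
    exact: segment_compact.
  apply: subclosed_compact clA cB _ => v oM k.
  case/mxvec_indexP: k => i j.
  have := orthogonal_entry_le1 _ _ _ i j oM.
  by rewrite mxE in_itv/= ler_norml.
have cf : {within A, continuous (fun v => l1norm (vec_mx v))}%classic.
  apply: continuous_subspaceT.
  apply: continuous_big => [|i _]; first exact: add_continuous.
  apply: continuous_big => [|j _]; first exact: add_continuous.
  move=> v.
  have h := continuous_comp (continuous_vec_mx R n n i j v)
    (@norm_continuous R R^o (vec_mx v i j)).
  exact: h.
have [c cA' cmax] := EVT_max_rV A0 cA cf.
exists (vec_mx c); first by move: cA'; rewrite inE.
move=> N oN; rewrite -[N]mxvecK; apply: cmax.
by rewrite inE /A/= mxvecK.
Qed.

(* Evaluate the hypothesis at the angle of the vector (a, b). *)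
Lemma circle_max (R : realType) (a b t : R) :
  (forall c s, c ^+ 2 + s ^+ 2 = 1 -> a * c + b * s <= t) ->
  a ^+ 2 + b ^+ 2 <= t ^+ 2.
Proof.
move=> H; have [->|n0] := eqVneq (a ^+ 2 + b ^+ 2) 0; first exact: sqr_ge0.
have h0 : 0 < a ^+ 2 + b ^+ 2 by rewrite lt_def n0 addr_ge0 ?sqr_ge0.
set h := Num.sqrt (a ^+ 2 + b ^+ 2).
have hp : 0 < h by rewrite sqrtr_gt0.
have h2 : h ^+ 2 = a ^+ 2 + b ^+ 2 by rewrite sqr_sqrtr// ltW.
have hn : h != 0 by rewrite gt_eqF.
have := H (a / h) (b / h).
have -> : (a / h) ^+ 2 + (b / h) ^+ 2 = 1.
  by rewrite !expr_div_n -mulrDl -h2 divff// expf_neq0.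
have -> : a * (a / h) + b * (b / h) = h.
  by rewrite !mulrA -mulrDl -!expr2 -h2 expr2 mulfK.
move=> /(_ erefl) le; rewrite -h2 ler_pXn2r// ?nnegrE; first exact: ltW.
exact: le_trans (ltW hp) le.
Qed.

(** * Bilinear forms and plane rotations *)

Definition bilin (R : realType) n (P : 'M[R]_n) (x y : 'cV[R]_n) : R :=
  (x^T *m P *m y) 0 0.
Arguments bilin {R n} P x y.

Lemma bilinBl (R : realType) n (P : 'M[R]_n) x y z :
  bilin P (x - y) z = bilin P x z - bilin P y z.
Proof. by rewrite /bilin raddfB/= !mulmxBl !mxE. Qed.

Lemma bilinBr (R : realType) n (P : 'M[R]_n) x y z :
  bilin P x (y - z) = bilin P x y - bilin P x z.
Proof. by rewrite /bilin mulmxBr !mxE. Qed.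

Lemma bilinZl (R : realType) n (P : 'M[R]_n) a x y :
  bilin P (a *: x) y = a * bilin P x y.
Proof. by rewrite /bilin linearZ/= -!scalemxAl mxE. Qed.

Lemma bilinZr (R : realType) n (P : 'M[R]_n) a x y :
  bilin P x (a *: y) = a * bilin P x y.
Proof. by rewrite /bilin -scalemxAr mxE. Qed.

Lemma mxtrace_outer (R : realType) n (P : 'M[R]_n) (x y : 'cV[R]_n) :
  \tr (x *m y^T *m P) = bilin P y x.
Proof.
by rewrite -mulmxA mxtrace_mulC /mxtrace big_ord1.
Qed.

Lemma bilin_delta (R : realType) n (P : 'M[R]_n) i j :
  bilin P (delta_mx i 0) (delta_mx j 0) = P i j.
Proof. by rewrite /bilin trmx_delta -rowE -colE !mxE. Qed.

Lemma bilin_mull (R : realType) n (P M : 'M[R]_n) x y :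
  bilin P (M *m x) y = bilin (M^T *m P) x y.
Proof. by rewrite /bilin trmx_mul !mulmxA. Qed.

Lemma bilin_mulr (R : realType) n (P M : 'M[R]_n) x y :
  bilin P x (M *m y) = bilin (P *m M) x y.
Proof. by rewrite /bilin !mulmxA. Qed.

Lemma dot_bilin (R : realType) n (x y : 'cV[R]_n) :
  x^T *m y = (bilin 1%:M x y)%:M.
Proof. by rewrite /bilin mulmx1 -mx11_scalar. Qed.

Lemma bilin_outer (R : realType) n (x y a b : 'cV[R]_n) :
  bilin (x *m y^T) a b = bilin 1%:M a x * bilin 1%:M y b.
Proof. by rewrite /bilin !mulmx1 mulmxA -mulmxA mxE big_ord1. Qed.

Lemma bilinB (R : realType) n (P Q : 'M[R]_n) x y :
  bilin (P - Q) x y = bilin P x y - bilin Q x y.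
Proof. by rewrite /bilin mulmxBr mulmxBl !mxE. Qed.

Lemma bilinZ (R : realType) n a (P : 'M[R]_n) x y :
  bilin (a *: P) x y = a * bilin P x y.
Proof. by rewrite /bilin -scalemxAr -scalemxAl mxE. Qed.

(** For orthonormal [e], [w] and [c ^+ 2 + s ^+ 2 = 1]: sends [e] to [c e - s w] and [w] to
    [s e + c w], and fixes the orthogonal complement of the plane. *)
Definition plane_rotation (R : realType) n (e w : 'cV[R]_n) (c s : R) : 'M[R]_n :=
  1%:M + (c - 1) *: (e *m e^T + w *m w^T) + s *: (e *m w^T - w *m e^T).
Arguments plane_rotation {R n} e w c s.

Lemma plane_rotation_orthogonal (R : realType) n (e w : 'cV[R]_n) (c s : R) :
  e^T *m e = 1%:M -> w^T *m w = 1%:M -> e^T *m w = 0 -> c ^+ 2 + s ^+ 2 = 1 ->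
  orthogonal_mx (plane_rotation e w c s).
Proof.
move=> ee ww ew cs.
have we : w^T *m e = 0 by rewrite -[LHS]trmxK trmx_mul trmxK ew trmx0.
have outer (x y z t : 'cV[R]_n) (a : R) : y^T *m z = a%:M ->
    x *m y^T *m (z *m t^T) = a *: (x *m t^T).
  move=> yz; rewrite mulmxA -(mulmxA x) yz mul_mx_scalar.
  by rewrite -scalemxAl.
have ew0 : e^T *m w = 0%:M by rewrite ew raddf0.
have we0 : w^T *m e = 0%:M by rewrite we raddf0.
(* [A] is the projection onto the plane and [B] a quarter turn in it, so they multiply like 1 and
   the imaginary unit. In the product with the transpose, the coefficient of [A] is then
   [c ^+ 2 + s ^+ 2 - 1]. *)
pose A := e *m e^T + w *m w^T; pose B := e *m w^T - w *m e^T.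
have AA : A *m A = A.
  rewrite /A mulmxDl !mulmxDr (outer _ _ _ _ _ ee) (outer _ _ _ _ _ ww).
  by rewrite (outer _ _ _ _ _ ew0) (outer _ _ _ _ _ we0) !scale1r !scale0r
    addr0 add0r.
have AB : A *m B = B.
  rewrite /A /B mulmxDl !mulmxBr (outer _ _ _ _ _ ee) (outer _ _ _ _ _ ww).
  by rewrite (outer _ _ _ _ _ ew0) (outer _ _ _ _ _ we0) !scale1r !scale0r
    subr0 add0r.
have BA : B *m A = B.
  rewrite /A /B mulmxBl !mulmxDr (outer _ _ _ _ _ ee) (outer _ _ _ _ _ ww).
  by rewrite (outer _ _ _ _ _ ew0) (outer _ _ _ _ _ we0) !scale1r !scale0r
    addr0 add0r.
have BB : B *m B = - A.
  rewrite /A /B mulmxBl !mulmxBr (outer _ _ _ _ _ ee) (outer _ _ _ _ _ ww).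
  rewrite (outer _ _ _ _ _ ew0) (outer _ _ _ _ _ we0) !scale1r !scale0r.
  by rewrite subr0 sub0r opprD.
have At : A^T = A by rewrite /A raddfD /= !trmx_mul !trmxK.
have Bt : B^T = - B by rewrite /B raddfB /= !trmx_mul !trmxK opprB.
have Qt : (1%:M + (c - 1) *: A + s *: B)^T = 1%:M + (c - 1) *: A - s *: B.
  by rewrite linearD linearD 2!linearZ /= trmx1 At Bt scalerN.
rewrite /orthogonal_mx /plane_rotation -/A -/B Qt.
rewrite !mulmxDl !mulmxDr !mulmxN !mul1mx !mulmx1 -!scalemxAl -!scalemxAr.
rewrite AA AB BA BB.
apply/matrixP => i j; clearbody A B; rewrite !mxE.
have s2 : s ^+ 2 = 1 - c ^+ 2 by rewrite -cs; ring.
ring: s2.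
Qed.

(** The trace is affine in [c] and [s], so optimality over all angles becomes a hypothesis of
    [circle_max]. *)
Lemma mxtrace_plane_rotation (R : realType) n (P : 'M[R]_n) e w c s :
  \tr (plane_rotation e w c s *m P) =
  \tr P + (c - 1) * (bilin P e e + bilin P w w) +
  s * (bilin P w e - bilin P e w).
Proof.
rewrite /plane_rotation !mulmxDl mul1mx -!scalemxAl !raddfD/= !mxtraceZ.
by rewrite mulmxBl mulmxDl raddfD raddfB/= !mxtrace_outer.
Qed.

(** * Sign patterns and the l1 norm as a trace *)

Lemma mxtrace_le_l1norm (R : realType) n (X S : 'M[R]_n) :
  (forall i j, `|S i j| <= 1) -> \tr (X *m S^T) <= l1norm X.
Proof.
move=> S1; rewrite /mxtrace; apply: ler_sum => i _; rewrite mxE.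
apply: ler_sum => j _; rewrite mxE.
by rewrite (le_trans (ler_norm _))// normrM ler_piMr.
Qed.

(** A zero entry gets sign 1, so that every sign squares to 1. *)
Definition sgn_mx (R : realType) n (M : 'M[R]_n) : 'M[R]_n :=
  \matrix_(i, j) (if 0 <= M i j then 1 else -1).
Arguments sgn_mx {R n} M.

Lemma mul_sgn_mx (R : realType) n (M : 'M[R]_n) i j :
  M i j * sgn_mx M i j = `|M i j|.
Proof.
by rewrite mxE; case: ger0P => _; rewrite ?mulr1 ?mulrN1.
Qed.

Lemma mxtrace_sgn_mx (R : realType) n (M : 'M[R]_n) :
  \tr (M *m (sgn_mx M)^T) = l1norm M.
Proof.
apply: eq_bigr => i _; rewrite mxE; apply: eq_bigr => j _.
by rewrite [_^T _ _]mxE mul_sgn_mx.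
Qed.

(** * The entry inequality at a maximizer *)

Lemma l1norm_max_entry (R : realType) n (M : 'M[R]_n) i j :
  orthogonal_mx M ->
  (forall N : 'M[R]_n, orthogonal_mx N -> l1norm N <= l1norm M) ->
  `|M i j| < 1 ->
  1 + `|M i j| ^+ 2 <= `|M i j| * (\sum_k `|M i k| + \sum_k `|M k j|).
Proof.
move=> oM maxM d1.
set rho := \sum_k _; set kap := \sum_k _.
pose S := sgn_mx M; pose sg := S i j; pose d := M i j.
have sgd : sg * d = `|M i j| by rewrite mulrC /sg /d /S mul_sgn_mx.
have sg2 : sg ^+ 2 = 1.
  by rewrite /sg /S mxE; case: ifP; rewrite ?sqrrN expr1n.
have r2_gt0 : 0 < 1 - d ^+ 2.
  by rewrite subr_gt0 -real_normK ?num_real// expr_lt1.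
pose r := Num.sqrt (1 - d ^+ 2).
have r_gt0 : 0 < r by rewrite sqrtr_gt0.
have r2 : r ^+ 2 = 1 - d ^+ 2 by rewrite sqr_sqrtr// ltW.
have r0 : r != 0 by rewrite gt_eqF.
have MM : M^T *m M = 1%:M by exact: mulmx1C.
pose P := M *m S^T.
pose e : 'cV[R]_n := delta_mx i 0; pose v : 'cV[R]_n := M *m delta_mx j 0.
(* Since [M^T *m M = 1%:M], moving [M] out of [v] turns [P] into [S^T] or [S^T *m M]; the three
   values are then entries of [P], [S^T] and [S^T *m M]. *)
have Pee : bilin P e e = rho.
  rewrite bilin_delta mxE; apply: eq_bigr => k _.
  by rewrite [_^T _ _]mxE mul_sgn_mx.
have Pve : bilin P v e = sg.
  by rewrite bilin_mull mulmxA MM mul1mx bilin_delta mxE.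
have Pvv : bilin P v v = kap.
  rewrite bilin_mull bilin_mulr mulmxA MM mul1mx bilin_delta mxE.
  by apply: eq_bigr => k _; rewrite [_^T _ _]mxE mulrC mul_sgn_mx.
have Iee : bilin 1%:M e e = 1 by rewrite bilin_delta mxE eqxx.
have Ive : bilin 1%:M v e = d.
  by rewrite bilin_mull mulmx1 bilin_delta mxE.
have Iev : bilin 1%:M e v = d.
  by rewrite bilin_mulr mul1mx bilin_delta.
have Ivv : bilin 1%:M v v = 1.
  by rewrite bilin_mull bilin_mulr mulmx1 MM bilin_delta mxE eqxx.
(* Gram-Schmidt: [v - d *: e] has squared norm [1 - d ^+ 2], which is nonzero because the entry has
   absolute value below 1. *)
pose w := r^-1 *: (v - d *: e).
pose bE := (bilinZl, bilinZr, bilinBl, bilinBr).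
have Iww : bilin 1%:M w w = 1.
  rewrite /w !bE Iee Ive Iev Ivv mulrA -expr2 exprVn r2.
  by field; rewrite gt_eqF.
have Iew : bilin 1%:M e w = 0 by rewrite /w !bE Iee Iev mulr1 subrr mulr0.
have Iwv : bilin 1%:M w v = r.
  by rewrite /w !bE Ivv Iev -expr2 -r2 expr2 mulrA mulVf// mul1r.
have rot c s : c ^+ 2 + s ^+ 2 = 1 ->
    orthogonal_mx (plane_rotation e w c s *m M).
  move=> cs; apply: orthogonal_mxM => //; apply: plane_rotation_orthogonal => //.
  - by rewrite dot_bilin Iee.
  - by rewrite dot_bilin Iww.
  - by rewrite dot_bilin Iew raddf0.
(* The left side is at most the l1 norm of the rotated [M], hence at most that of [M], which is
   [\tr P]. *)
have test (S' : 'M[R]_n) c s :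
    (forall a b, `|S' a b| <= 1) -> c ^+ 2 + s ^+ 2 = 1 ->
    \tr (plane_rotation e w c s *m (M *m S'^T)) <= \tr P.
  move=> S1 cs; rewrite mulmxA mxtrace_sgn_mx.
  exact: le_trans (mxtrace_le_l1norm _ _ _ _ S1) (maxM _ (rot _ _ cs)).
have S1 a b : `|S a b| <= 1.
  by rewrite mxE; case: ifP => _; rewrite ?normrN normr1.
pose T := rho + bilin P w w.
(* First-order optimality of M along the rotation. *)
have Psym : bilin P w e = bilin P e w.
  have /circle_max : forall c s, c ^+ 2 + s ^+ 2 = 1 ->
      T * c + (bilin P w e - bilin P e w) * s <= T.
    move=> c s cs; have := test S c s S1 cs.
    rewrite mxtrace_plane_rotation Pee -/T; lra.
  rewrite gerDl => h; apply/eqP; rewrite -subr_eq0 -sqrf_eq0.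
  by rewrite eq_le h sqr_ge0.
(* Symmetry on [e], [w] passes to [e], [v], as [w] is a combination of them. *)
have Pev : bilin P e v = sg.
  move: Psym; rewrite /w !bE Pve Pee => /(mulfI _) h.
  have /h : r^-1 != 0 by rewrite invr_eq0.
  by move/addIr.
have TE : (1 - d ^+ 2) * T = rho + kap - 2 * `|M i j|.
  rewrite /T /w !bE Pvv Pve Pev Pee -sgd -r2.
  by field: r2.
(* The same rotation tested against S with the sign at (i, j) flipped. *)
pose S' := S - (2 * sg) *: delta_mx i j.
have S'1 a b : `|S' a b| <= 1.
  have -> : S' a b = S a b - 2 * sg * ((a == i) && (b == j))%:R.
    by rewrite [LHS]mxE; congr (_ + _); rewrite !mxE.
  have [/andP[/eqP-> /eqP->]|_] := boolP ((a == i) && (b == j)).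
    have -> : S i j - 2 * sg * 1 = - sg by rewrite /sg; ring.
    by rewrite normrN; exact: S1.
  by rewrite mulr0 subr0.
(* Flipping one sign is a rank-one change of [P]. *)
have PE : M *m S'^T = P - (2 * sg) *: (v *m e^T).
  rewrite /S' linearB linearZ/= trmx_delta mulmxBr -scalemxAr.
  by rewrite /v /e trmx_delta -mulmxA mul_delta_mx.
have /circle_max : forall c s, c ^+ 2 + s ^+ 2 = 1 ->
    (T - 2 * (sg * d)) * c + (- 2 * sg * r) * s <= T.
  move=> c s cs; have := test S' c s S'1 cs.
  rewrite PE mxtrace_plane_rotation !bilinB !bilinZ !bilin_outer.
  rewrite raddfB/= mxtraceZ -[v *m e^T]mulmx1 mxtrace_outer.
  rewrite Iee Iev Iew Iwv Psym Pee /T; lra.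
have -> : (-2 * sg * r) ^+ 2 = 4 * (1 - d ^+ 2).
  by rewrite !exprMn sg2 r2; ring.
have d2 : d ^+ 2 = `|M i j| ^+ 2 by rewrite real_normK ?num_real.
rewrite sgd => h.
(* Expanding [h], the squares of [T] and of the entry cancel. *)
have : 1 <= T * `|M i j| by nra.
have d0 : 0 <= `|M i j| by [].
(* Multiply by the positive [1 - d ^+ 2] and substitute [TE]; the term [- 2 d ^+ 2] moves across to
   give [1 + d ^+ 2]. *)
rewrite d2 in TE r2_gt0 *.
nra.
Qed.

(* For every positive integer m = n+1: l_m >= 1 / (2 sqrt m). *)
Theorem theorem2p2 (R : realType) (n : nat) :
  1 / (2 * Num.sqrt (n.+1%:R : R)) <= l_ R n.
Proof.
have [M oM maxM] := orthogonal_l1norm_max R n.+1.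
have entry i j : 1 / (2 * Num.sqrt (n.+1%:R : R)) <= `|M i j|.
  set q := Num.sqrt _.
  have q1 : 1 <= q by rewrite -[leLHS]sqrtr1 ler_sqrt ?ler1n ?ltr0n.
  rewrite ler_pdivrMr; last lra.
  (* At absolute value 1 the rotation plane degenerates, but the bound is immediate from
     [1 <= q]. *)
  have [d1|d1] := ltP `|M i j| 1; last by nra.
  have := l1norm_max_entry _ _ _ i j oM maxM d1.
  have := orthogonal_row_l1_le _ _ _ i oM.
  have := orthogonal_row_l1_le _ _ _ j (orthogonal_mx_tr _ _ _ oM).
  under eq_bigr do rewrite mxE.
  rewrite -/q => col row h.
  have d0 : 0 <= `|M i j| by [].
  nra.
apply: (@le_trans _ _ (lM M)).
  (* The initial value of each minimum is itself an entry, so [entry] bounds it too. *)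
  apply: le_bigmin => [|i _]; first exact: entry.
  by apply: le_bigmin => [|j _]; exact: entry.
apply: ub_le_sup; last by exists M.
(* The supremum needs an upper bound: each minimum is at most its initial value, an entry of
   absolute value at most 1. *)
exists 1 => _ [N oN <-].
apply: le_trans (orthogonal_entry_le1 _ _ _ ord0 ord0 oN).
by apply: bigmin_le_id.
Qed.
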